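(* Let the plant be $$\dot{\mathbf x}_1=\mathbf f_1(\mathbf x)+\mathbf g_1(\mathbf x)u,\qquad \dot{\mathbf x}_2=\mathbf f_2(\mathbf x)+\boldsymbol\nu(\mathbf x,\boldsymbol\theta)+\mathbf g_2(\mathbf x)u,$$ with control $u=u(\mathbf x,\hat{\boldsymbol\theta},t)$. Suppose that for the given functions $\boldsymbol\alpha(\mathbf x,t)\in R^d$ and $\psi(\mathbf x,t)\in R$ there exists a (differentiable) function $\Psi(\mathbf x,t)\in R^d$ such that $$\frac{\partial\Psi(\mathbf x,t)}{\partial\mathbf x_2}=\psi(\mathbf x,t)\frac{\partial\boldsymbol\alpha(\mathbf x,t)}{\partial\mathbf x_2}.$$ Then the adaptation algorithm $$\dot{\hat{\boldsymbol\theta}}=\Gamma(\varphi(\psi)+\dot\psi)\boldsymbol\alpha(\mathbf x,t),\qquad\Gamma>0,$$ has the following finite-form realization: $$\hat{\boldsymbol\theta}(\mathbf x,t)=\Gamma(\hat{\boldsymbol\theta}_P(\mathbf x,t)+\hat{\boldsymbol\theta}_I(t)),\qquad \hat{\boldsymbol\theta}_P(\mathbf x,t)=\psi(\mathbf x,t)\boldsymbol\alpha(\mathbf x,t)-\Psi(\mathbf x,t),$$ $$\dot{\hat{\boldsymbol\theta}}_I=\varphi(\psi(\mathbf x,t))\boldsymbol\alpha(\mathbf x,t)+\frac{\partial\Psi(\mathbf x,t)}{\partial t}-\psi(\mathbf x,t)\frac{\partial\boldsymbol\alpha(\mathbf x,t)}{\partial t}-\left(\psi(\mathbf x,t)L_{\mathbf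 f_1}\boldsymbol\alpha(\mathbf x,t)-L_{\mathbf f_1}\Psi(\mathbf x,t)\right)-\left(\psi(\mathbf x,t)L_{\mathbf g_1}\boldsymbol\alpha(\mathbf x,t)-L_{\mathbf g_1}\Psi(\mathbf x,t)\right)u(\mathbf x,\hat{\boldsymbol\theta},t).$$ That is, along the solutions of the plant in closed loop with this algorithm, $\hat{\boldsymbol\theta}(\mathbf x(t),t)$ satisfies $\dot{\hat{\boldsymbol\theta}}=\Gamma(\varphi(\psi)+\dot\psi)\boldsymbol\alpha(\mathbf x,t)$.
   Context: $\mathbf x=\mathbf x_1\oplus\mathbf x_2\in R^n$ ($\oplus$ is concatenation), $\mathbf x_1=(x_1,\dots,x_m)^T$, $\mathbf x_2=(x_{m+1},\dots,x_n)^T$; $\mathbf f=\mathbf f_1\oplus\mathbf f_2$, $\mathbf g=\mathbf g_1\oplus\mathbf g_2$ are $C^1$, $\boldsymbol\nu:R^n\times R^d\to R^{n-m}$ is $C^1$, $\boldsymbol\theta\in\Omega_\theta\subset R^d$ is a constant vector of unknown parameters, $u\in R$ is the input. The goal function $\psi:R^n\times R\to R$ and $\boldsymbol\alpha:R^n\times R\to R^d$ are differentiable as many times as needed, $\varphi:R\to R$ is continuous; $\dot\psi$ is the total time derivative of $\psi(\mathbf x(t),t)$ along the solution. The control is $$u(\mathbf x,\hat{\boldsymbol\theta},t)=(L_{\mathbf g}\psi)^{-1}\left(-\varphi(\psi)-L_{\mathbf f}\psi-L_{\boldsymbol\nu(\mathbf x,\hat{\boldsymbol\theta})}\psi-\partial\psi/\partial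 t\right),$$ where it is presupposed that $|L_{\mathbf g}\psi(\mathbf x,t)|>\delta_1>0$ for all $\mathbf x,t$. Notation: $L_{\mathbf f}\psi=\frac{\partial\psi}{\partial\mathbf x}\mathbf f$, $L_{\mathbf g}\psi=\frac{\partial\psi}{\partial\mathbf x}\mathbf g$, $L_{\boldsymbol\nu}\psi=\frac{\partial\psi}{\partial\mathbf x_2}\boldsymbol\nu$; for a partition component, $L_{\mathbf f_1}\boldsymbol\alpha=\frac{\partial\boldsymbol\alpha}{\partial\mathbf x_1}\mathbf f_1$, $L_{\mathbf g_1}\boldsymbol\alpha=\frac{\partial\boldsymbol\alpha}{\partial\mathbf x_1}\mathbf g_1$ (componentwise), and similarly for $\Psi$. $\Gamma>0$ is a symmetric positive definite $d\times d$ gain. An algorithm is in finite form if $\hat{\boldsymbol\theta}$ is the sum (up to the gain) of a function of $(\mathbf x,t)$ and a term $\hat{\boldsymbol\theta}_I(t)$ whose derivative is a function of $(\mathbf x,\hat{\boldsymbol\theta},t)$, none of these functions involving the unknown $\boldsymbol\theta$ or state derivatives. *)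

(* Defs.v *)
From mathcomp Require Export all_boot all_order all_algebra.
From mathcomp Require Export boolp classical_sets reals topology normedtype derive.
Export Order.TTheory GRing.Theory Num.Theory numFieldNormedType.Exports.

Set Implicit Arguments.
Unset Strict Implicit.
Unset Printing Implicit Defensive.

Local Open Scope classical_set_scope.
Local Open Scope ring_scope.

(* The state x = x1 (+) x2 is a column vector of size m + p (so n = m + p), with
   x1 = usubmx x and x2 = dsubmx x; likewise for the vector fields f and g.
   Functions of (x, t) are defined on the product space 'cV[R]_(m + p) * R. *)

Section Calculus.
Variable R : realType.

(* In finite dimension, continuity of every directional derivative is
   continuity of the differential. *)
Definition C1 (V W : normedModType R) (F : V -> W) : Prop :=
  (forall x, differentiable F x) /\ (forall v, continuous ('D_v F)).

Definition symmetric_posdef (d : nat) (A : 'M[R]_d) : Prop :=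
  A^T = A /\ forall v : 'cV[R]_d, v != 0 -> 0 < (v^T *m A *m v) 0 0.

(* Difference quotients are restricted to J, so that the derivative is one-sided
   at an end point belonging to J. *)
Definition has_derivative_on (V : normedModType R) (J : set R) (h h' : R -> V) :
    Prop :=
  forall t, J t ->
    (s - t)^-1 *: (h s - h t) @[s --> within J t^'] --> h' t.

Variables m p : nat.
Implicit Types (x : 'cV[R]_(m + p)) (t : R).

Definition dpsi_dx (psi : 'cV[R]_(m + p) * R -> R) x t : 'rV[R]_(m + p) :=
  \row_j 'D_(delta_mx j 0) (fun y => psi (y, t)) x.

Definition dpsi_dx2 (psi : 'cV[R]_(m + p) * R -> R) x t : 'rV[R]_p :=
  rsubmx (dpsi_dx psi x t).

Section VectorValued.
Variables (d : nat) (F : 'cV[R]_(m + p) * R -> 'cV[R]_d).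

Definition dF_dx x t : 'M[R]_(d, m + p) :=
  \matrix_(i, j) 'D_(delta_mx j 0) (fun y => F (y, t) i 0) x.

Definition dF_dx1 x t : 'M[R]_(d, m) := lsubmx (dF_dx x t).
Definition dF_dx2 x t : 'M[R]_(d, p) := rsubmx (dF_dx x t).
End VectorValued.

Definition d_dt (V : normedModType R) (F : 'cV[R]_(m + p) * R -> V) x t : V :=
  derive1 (fun s => F (x, s)) t.

Definition Lie (h : 'cV[R]_(m + p) -> 'cV[R]_(m + p))
    (psi : 'cV[R]_(m + p) * R -> R) x t : R :=
  (dpsi_dx psi x t *m h x) 0 0.

(* v is a vector of R^p acting along x2 only: the value of nu. *)
Definition Lie2 (v : 'cV[R]_p) (psi : 'cV[R]_(m + p) * R -> R) x t : R :=
  (dpsi_dx2 psi x t *m v) 0 0.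

(* Derivative of F along the first component h1 of h = h1 (+) h2. *)
Definition Lie1 (h : 'cV[R]_(m + p) -> 'cV[R]_(m + p)) (d : nat)
    (F : 'cV[R]_(m + p) * R -> 'cV[R]_d) x t : 'cV[R]_d :=
  dF_dx1 F x t *m usubmx (h x).

End Calculus.

Section Adaptation.
Variables (R : realType) (m p d : nat).
Implicit Types (x : 'cV[R]_(m + p)) (t : R) (th : 'cV[R]_d).

Definition control (f g : 'cV[R]_(m + p) -> 'cV[R]_(m + p))
    (nu : 'cV[R]_(m + p) * 'cV[R]_d -> 'cV[R]_p) (phi : R -> R)
    (psi : 'cV[R]_(m + p) * R -> R) x th t : R :=
  (Lie g psi x t)^-1 *
  (- phi (psi (x, t)) - Lie f psi x t - Lie2 (nu (x, th)) psi x t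
   - d_dt psi x t).

(* thetahat = ff_gain (ff_P (x, t) + thetaI), where the derivative of thetaI is
   ff_rhs x thetahat t.  The fields are fixed before the unknown parameter and
   the trajectory are, so they depend on neither theta nor state derivatives. *)
Record finite_form := FiniteForm {
  ff_gain : 'M[R]_d;
  ff_P : 'cV[R]_(m + p) * R -> 'cV[R]_d;
  ff_rhs : 'cV[R]_(m + p) -> 'cV[R]_d -> R -> 'cV[R]_d
}.

Definition ff_estimate (A : finite_form) (x : R -> 'cV[R]_(m + p))
    (thI : R -> 'cV[R]_d) t : 'cV[R]_d :=
  ff_gain A *m (ff_P A (x t, t) + thI t).

Definition closed_loop_solution
    (f g : 'cV[R]_(m + p) -> 'cV[R]_(m + p))
    (nu : 'cV[R]_(m + p) * 'cV[R]_d -> 'cV[R]_p) (theta : 'cV[R]_d)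
    (u : 'cV[R]_(m + p) -> 'cV[R]_d -> R -> R) (A : finite_form)
    (J : set R) (x : R -> 'cV[R]_(m + p)) (thI : R -> 'cV[R]_d) : Prop :=
  let thetahat := ff_estimate A x thI in
  [/\ has_derivative_on J (fun t => usubmx (x t))
        (fun t => usubmx (f (x t))
                  + u (x t) (thetahat t) t *: usubmx (g (x t))),
      has_derivative_on J (fun t => dsubmx (x t))
        (fun t => dsubmx (f (x t)) + nu (x t, theta)
                  + u (x t) (thetahat t) t *: dsubmx (g (x t))) &
      has_derivative_on J thI (fun t => ff_rhs A (x t) (thetahat t) t)].

(* d thetahat / dt = Gamma (phi(psi) + d psi / dt) alpha along x, where
   d psi / dt is the total derivative of t |-> psi (x t, t). *)
Definition adaptation_law (Gamma : 'M[R]_d) (phi : R -> R)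
    (psi : 'cV[R]_(m + p) * R -> R) (alpha : 'cV[R]_(m + p) * R -> 'cV[R]_d)
    (J : set R) (x : R -> 'cV[R]_(m + p)) (thetahat : R -> 'cV[R]_d) : Prop :=
  exists psidot : R -> R,
    has_derivative_on J (fun t => psi (x t, t)) psidot /\
    has_derivative_on J thetahat
      (fun t => Gamma *m ((phi (psi (x t, t)) + psidot t) *: alpha (x t, t))).

End Adaptation.

(* Main.v *)
From HB Require Import structures.
Require Import Defs.
From mathcomp Require Import functions landau ring.

Set Implicit Arguments.
Unset Strict Implicit.
Unset Printing Implicit Defensive.

Local Open Scope classical_set_scope.
Local Open Scope ring_scope.

(** The feedback psidot in the adaptation law contains the unknown velocity of
x2. Integration by parts trades psidot alpha for the total derivative of
psi alpha minus psi times the total derivative of alpha, and the only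
inaccessible part of the latter is
[psi (d alpha / d x2) x2' = (d Psi / d x2) x2'],
which is the x2-part of the total derivative of Psi. So psidot alpha is the
derivative of psi alpha - Psi up to terms in (x, thetahat, t) only, and these
are exactly what the right-hand side for thetaI supplies. The resulting
identity is purely algebraic ([x2_terms_cancel]).

The analytic part is that [has_derivative_on], a limit of difference quotients
restricted to J, obeys the product rule ([has_derivative_onZ]) and the chain rule
for a Fréchet differentiable outer function ([has_derivative_on_comp]), and that
the differential at (x, t) is assembled from the partial derivatives that define
the Lie derivatives ([diff_partials]). *)

(** * Derivatives relative to a subset of the line *)

Section DerivativeOn.
Variable R : realType.
Implicit Types (V W : normedModType R) (J : set R).

Lemma has_derivative_on_continuous V J (h h' : R -> V) t :
  has_derivative_on J h h' -> J t -> h s @[s --> within J t^'] --> h t.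
Proof.
move=> hh' Jt.
(* h s = h t + (s - t) q(s) where the difference quotient q converges. *)
have st : s - t @[s --> within J t^'] --> (0 : R).
  rewrite -(subrr t); apply: cvgB; last exact: cvg_cst.
  by apply: cvg_trans (cvg_within _) _; exact: nbhs_dnbhs.
rewrite -[h t]addr0 -(scale0r (h' t)).
apply: cvg_trans (cvgD (cvg_cst (h t)) (cvgZ st (hh' t Jt))).
apply: near_eq_cvg; rewrite near_withinE; near=> s => _.
have st0 : s - t != 0 by rewrite subr_eq0; near: s; exact: nbhs_dnbhs_neq.
by rewrite fctE scalerA divff// scale1r addrC subrK.
Unshelve. all: by end_near. Qed.

(** The increment of F is its differential at the increment of h, plus a
remainder negligible with respect to that increment. After division by s - t the
first term converges by continuity of the differential, and the second vanishes
because the difference quotient of h, being convergent, is bounded. *)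
Lemma has_derivative_on_comp V W J (h h' : R -> V) (F : V -> W) :
  has_derivative_on J h h' -> (forall t, J t -> differentiable F (h t)) ->
  has_derivative_on J (F \o h) (fun t => 'd F (h t) (h' t)).
Proof.
move=> hh' dF t Jt.
have hc := has_derivative_on_continuous hh' Jt.
have qcvg := hh' t Jt.
set q := (fun s => (s - t)^-1 *: (h s - h t)) in qcvg.
pose k (v : V) : W := F (v + h t) - (F (h t) + 'd F (h t) v).
have kE s : (s - t)^-1 *: (F (h s) - F (h t)) =
    'd F (h t) (q s) + (s - t)^-1 *: k (h s - h t).
  by rewrite /k /q linearZ -scalerDr subrK [F (h t) + _]addrC opprD
             [F (h s) + (_ + _)]addrCA addNKr.
have klittle : forall e, 0 < e -> \forall v \near 0, `|k v| <= e * `|v|.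
  by move=> e e0; have /diff_locally/eqaddoP/(_ e e0) := dF t Jt.
rewrite (eq_cvg _ _ kE).
rewrite -['d F _ _]addr0; apply: cvgD.
  by apply: continuous_cvg => //; apply: diff_continuous; exact: dF.
apply/cvgr0Pnorm_le => e e0.
pose M := `|h' t| + 1.
have M0 : 0 < M by rewrite ltr_wpDl.
have hB : h s - h t @[s --> within J t^'] --> (0 : V).
  by rewrite -(subrr (h t)); apply: cvgB => //; exact: cvg_cst.
have kB := hB _ (klittle (e / M) (divr_gt0 e0 M0)).
have qM : \forall s \near within J t^', `|q s| < M.
  by apply: cvgr_norm_lt qcvg _ _; rewrite ltrDl.
near=> s.
(* The remainder is at most e / M times the increment of h, and M bounds the
   difference quotient of h near t. *)
have kBs : `|k (h s - h t)| <= e / M * `|h s - h t| by near: s.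
rewrite normrZ (le_trans (ler_wpM2l (normr_ge0 _) kBs))// mulrCA -normrZ -/(q s).
by rewrite -mulrA ger_pMr// ler_pdivrMl// mulr1 ltW//; near: s.
Unshelve. all: by end_near. Qed.

Lemma has_derivative_onD V J (a a' b b' : R -> V) :
  has_derivative_on J a a' -> has_derivative_on J b b' ->
  has_derivative_on J (fun t => a t + b t) (fun t => a' t + b' t).
Proof.
move=> aa' bb' t Jt.
under eq_cvg do rewrite opprD addrACA scalerDr.
by apply: cvgD; [exact: aa'|exact: bb'].
Qed.

Lemma has_derivative_onN V J (a a' : R -> V) :
  has_derivative_on J a a' ->
  has_derivative_on J (fun t => - a t) (fun t => - a' t).
Proof.
move=> aa' t Jt.
by under eq_cvg do rewrite -opprD scalerN; apply: cvgN; exact: aa'.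
Qed.

Lemma has_derivative_onZ V J (c c' : R -> R) (a a' : R -> V) :
  has_derivative_on J c c' -> has_derivative_on J a a' ->
  has_derivative_on J (fun t => c t *: a t)
    (fun t => c' t *: a t + c t *: a' t).
Proof.
move=> cc' aa' t Jt.
have qE s : (s - t)^-1 *: (c s *: a s - c t *: a t) =
    ((s - t)^-1 *: (c s - c t)) *: a s + c t *: ((s - t)^-1 *: (a s - a t)).
  rewrite -scalerA scalerBl [c t *: (_ *: _)]scalerA [c t * _]mulrC -scalerA.
  by rewrite -scalerDr [c t *: (_ - _)]scalerBr addrA subrK.
rewrite (eq_cvg _ _ qE); apply: cvgD.
  by apply: cvgZ; [exact: cc'|exact: has_derivative_on_continuous aa' Jt].
by apply: cvgZ; [exact: cvg_cst|exact: aa'].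
Qed.

Lemma has_derivative_on_id J : has_derivative_on J id (fun=> 1 : R).
Proof.
move=> t Jt; apply: cvg_near_cst; rewrite near_withinE; near=> s => _.
have st0 : s - t != 0 by rewrite subr_eq0; near: s; exact: nbhs_dnbhs_neq.
exact: mulVf.
Unshelve. all: by end_near. Qed.

Lemma has_derivative_on_pair V W J (a a' : R -> V) (b b' : R -> W) :
  has_derivative_on J a a' -> has_derivative_on J b b' ->
  has_derivative_on J (fun t => (a t, b t)) (fun t => (a' t, b' t)).
Proof. by move=> aa' bb' t Jt; apply: cvg_pair; [exact: aa'|exact: bb']. Qed.

End DerivativeOn.

(** * Matrix-valued functions *)

Lemma cvg_mx (R : realType) (T : Type) m n (F : set_system T)
    {FF : Filter F} (A : T -> 'M[R]_(m, n)) (L : 'M[R]_(m, n)) :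
  (forall i j, A s i j @[s --> F] --> L i j) -> A s @[s --> F] --> L.
Proof.
move=> AL B [P LP PB].
have : \forall s \near F, forall i j, P i j (A s i j).
  by apply: filter_forall => i; apply: filter_forall => j; exact/AL/LP.
by apply: filterS => s Ps; exact: PB.
Qed.

Lemma mulmx_continuous (R : realType) m n p (A : 'M[R]_(m, n)) :
  continuous (mulmx A : 'M[R]_(n, p) -> 'M[R]_(m, p)).
Proof.
move=> B; apply: (@cvg_mx _ _ _ _ (nbhs B) _ (mulmx A)) => i j; rewrite mxE.
under eq_cvg do rewrite mxE.
apply: cvg_big => [|k _]; first exact: add_continuous.
apply: cvgM; first exact: cvg_cst.
exact: coord_continuous.
Qed.

Lemma has_derivative_on_mulmx (R : realType) m n p (A : 'M[R]_(m, n)) (J : set R)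
    (h h' : R -> 'M[R]_(n, p)) :
  has_derivative_on J h h' ->
  has_derivative_on J (fun t => A *m h t) (fun t => A *m h' t).
Proof.
move=> hh' t Jt.
have dA z : differentiable (mulmx A : 'M[R]_(n, p) -> _) z.
  by apply: linear_differentiable; exact: mulmx_continuous.
have := @has_derivative_on_comp _ _ _ _ _ _ (mulmx A) hh' (fun s _ => dA _) t Jt.
by rewrite diff_lin//; exact: mulmx_continuous.
Qed.

(** The plant prescribes the derivatives of x1 and x2 separately, whereas the
chain rule needs the derivative of x, a linear function of the two blocks. *)
Lemma has_derivative_on_col_mx (R : realType) m n p (J : set R)
    (h h' : R -> 'M[R]_(m + n, p)) :
  has_derivative_on J (fun t => usubmx (h t)) (fun t => usubmx (h' t)) ->
  has_derivative_on J (fun t => dsubmx (h t)) (fun t => dsubmx (h' t)) ->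
  has_derivative_on J h h'.
Proof.
move=> hu hd.
have colE (B : 'M[R]_(m + n, p)) :
    B = col_mx 1%:M 0 *m usubmx B + col_mx 0 1%:M *m dsubmx B.
  by rewrite !mul_col_mx !mul1mx !mul0mx add_col_mx addr0 add0r vsubmxK.
have funE (k : R -> 'M[R]_(m + n, p)) :
    k = fun t => col_mx 1%:M 0 *m usubmx (k t) + col_mx 0 1%:M *m dsubmx (k t).
  by apply/funext => t; exact: colE.
rewrite (funE h) (funE h').
by apply: has_derivative_onD; exact: has_derivative_on_mulmx.
Qed.

(** * Differential and partial derivatives *)

Lemma is_diff_coord (R : realType) m n (A : 'M[R]_(m, n)) i j :
  is_diff A (fun B : 'M[R]_(m, n) => B i j) (fun B => B i j).
Proof.
set c := fun B : 'M[R]_(m, n) => B i j.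
have lin_c : linear c by move=> a B C; rewrite /c !mxE.
pose cM := GRing.isLinear.Build _ _ _ _ _ lin_c.
pose cL : {linear _ -> _} := HB.pack c cM.
apply: DiffDef; first exact: differentiable_coord.
by rewrite (@diff_lin _ _ _ cL)//; exact: coord_continuous.
Qed.

Section Partials.
Variables (R : realType) (m p d : nat).
Variables (F : 'cV[R]_(m + p) * R -> 'cV[R]_d) (x : 'cV[R]_(m + p)) (t : R).
Hypothesis dF : differentiable F (x, t).

Let is_diffF : is_diff (x, t) F ('d F (x, t)) := differentiableP dF.

(** The partial derivatives are taken entry by entry on the restriction of F to
time t; both operations commute with the differential because the coordinate
maps are linear and y |-> (y, t) has differential v |-> (v, 0). *)
Lemma diff_delta j : 'd F (x, t) (delta_mx j 0, 0) = col j (dF_dx F x t).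
Proof.
apply/colP => i; rewrite !mxE.
have dFx : is_diff x (F \o (fun y => (y, t))) ('d F (x, t) \o (fun v => (v, 0))).
  exact: (is_diff_comp (is_diff_pair (is_diff_id x) (is_diff_cst t x)) is_diffF).
have dFi : is_diff x (fun y => F (y, t) i 0) (fun v => 'd F (x, t) (v, 0) i 0).
  exact: (is_diff_comp dFx (is_diff_coord _ i 0)).
by rewrite deriveE// (@diff_val _ _ _ _ _ _ _ dFi).
Qed.

Lemma diff_dF_dx (v : 'cV[R]_(m + p)) : 'd F (x, t) (v, 0) = dF_dx F x t *m v.
Proof.
have -> : (v, 0) = \sum_j v j 0 *: (delta_mx j 0, 0) :> 'cV[R]_(m + p) * R.
  rewrite [in LHS](matrix_sum_delta v).
  under eq_bigr do rewrite big_ord1.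
  elim/big_ind2 : _ => //.
    by move=> _ u1 _ u2 <- <-; congr pair; rewrite addr0.
  by move=> j _; congr pair; rewrite scaler0.
rewrite linear_sum; apply/colP => i; rewrite summxE mxE.
by apply: eq_bigr => j _; rewrite linearZ /= diff_delta !mxE mulrC.
Qed.

Lemma diff_d_dt : 'd F (x, t) (0, 1) = d_dt F x t.
Proof.
have dFt : is_diff t (F \o (fun s => (x, s))) ('d F (x, t) \o (fun s => (0, s))).
  exact: (is_diff_comp (is_diff_pair (is_diff_cst x t) (is_diff_id t)) is_diffF).
by rewrite /d_dt derive1E'// (@diff_val _ _ _ _ _ _ _ dFt).
Qed.

Lemma diff_partials (v : 'cV[R]_(m + p)) :
  'd F (x, t) (v, 1) = dF_dx1 F x t *m usubmx v + dF_dx2 F x t *m dsubmx v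
                       + d_dt F x t.
Proof.
have -> : (v, 1) = (v, 0) + (0, 1) :> 'cV[R]_(m + p) * R.
  by congr pair; rewrite ?addr0 ?add0r.
rewrite linearD diff_dF_dx diff_d_dt -mul_row_col vsubmxK.
by rewrite /dF_dx1 /dF_dx2 hsubmxK.
Qed.

End Partials.

(** * Total derivatives along a trajectory *)

Lemma has_derivative_on_trajectory (R : realType) m p (V : normedModType R)
    (F : 'cV[R]_(m + p) * R -> V) (J : set R) (x x' : R -> 'cV[R]_(m + p)) :
  (forall z, differentiable F z) -> has_derivative_on J x x' ->
  has_derivative_on J (fun t => F (x t, t)) (fun t => 'd F (x t, t) (x' t, 1)).
Proof.
move=> dF xx'.
have xt' := has_derivative_on_pair xx' (@has_derivative_on_id R J).
exact: (has_derivative_on_comp xt' (fun t _ => dF (x t, t))).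
Qed.

Lemma has_derivative_on_trajectory_partials (R : realType) m p d
    (F : 'cV[R]_(m + p) * R -> 'cV[R]_d) (J : set R)
    (x x' : R -> 'cV[R]_(m + p)) :
  (forall z, differentiable F z) -> has_derivative_on J x x' ->
  has_derivative_on J (fun t => F (x t, t))
    (fun t => dF_dx1 F (x t) t *m usubmx (x' t)
              + dF_dx2 F (x t) t *m dsubmx (x' t) + d_dt F (x t) t).
Proof.
move=> dF /(has_derivative_on_trajectory dF); congr has_derivative_on.
by apply/funext => t; exact: diff_partials.
Qed.

(** The algebra behind the finite form. Here v2 stands for the velocity of x2,
and the hypothesis makes its two occurrences cancel; primed and t-suffixed
variables stand for total and partial time derivatives, A1, A2, P1, P2 for the
Jacobian blocks of alpha and Psi, and f1 + c g1 for the
velocity of x1 under the input c. *)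
Lemma x2_terms_cancel (R : comPzRingType) m p d
    (phi psi psi' c : R) (alpha alphat Psit : 'cV[R]_d)
    (A1 P1 : 'M[R]_(d, m)) (A2 P2 : 'M[R]_(d, p))
    (f1 g1 : 'cV[R]_m) (v2 : 'cV[R]_p) :
  P2 = psi *: A2 ->
  psi' *: alpha + psi *: (A1 *m (f1 + c *: g1) + A2 *m v2 + alphat)
    - (P1 *m (f1 + c *: g1) + P2 *m v2 + Psit)
    + (phi *: alpha + Psit - psi *: alphat
       - (psi *: (A1 *m f1) - P1 *m f1)
       - c *: (psi *: (A1 *m g1) - P1 *m g1))
  = (phi + psi') *: alpha.
Proof.
move=> ->; rewrite !mulmxDr -!scalemxAl -!scalemxAr.
move: (A1 *m f1) (A1 *m g1) (P1 *m f1) (P1 *m g1) (A2 *m v2) => a b e f h.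
by apply/colP => i; rewrite !mxE; ring.
Qed.

Theorem theorem2 (R : realType) (m p d : nat)
  (f g : 'cV[R]_(m + p) -> 'cV[R]_(m + p))
  (nu : 'cV[R]_(m + p) * 'cV[R]_d -> 'cV[R]_p)
  (Omega : set 'cV[R]_d)
  (psi : 'cV[R]_(m + p) * R -> R)
  (alpha Psi : 'cV[R]_(m + p) * R -> 'cV[R]_d)
  (phi : R -> R) (delta1 : R) (Gamma : 'M[R]_d)
  (f_C1 : C1 f) (g_C1 : C1 g) (nu_C1 : C1 nu)
  (psi_diff : forall z, differentiable psi z)
  (alpha_diff : forall z, differentiable alpha z)
  (phi_cont : continuous phi)
  (delta1_gt0 : 0 < delta1)
  (Lg_psi_gt : forall x t, delta1 < `|Lie g psi x t|)
  (Gamma_pos : symmetric_posdef Gamma)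
  (Psi_diff : forall z, differentiable Psi z)
  (Psi_alpha : forall x t,
     dF_dx2 Psi x t = psi (x, t) *: dF_dx2 alpha x t) :
  let u := control f g nu phi psi in
  let algorithm := FiniteForm Gamma
    (fun z => psi z *: alpha z - Psi z)
    (fun x thetahat t =>
       phi (psi (x, t)) *: alpha (x, t)
       + d_dt Psi x t - psi (x, t) *: d_dt alpha x t
       - (psi (x, t) *: Lie1 f alpha x t - Lie1 f Psi x t)
       - u x thetahat t *: (psi (x, t) *: Lie1 g alpha x t - Lie1 g Psi x t)) in
  forall theta : 'cV[R]_d, Omega theta ->
  forall (J : interval R) (t0 t1 : R), t0 \in J -> t1 \in J -> t0 < t1 ->
  forall (x : R -> 'cV[R]_(m + p)) (thetaI : R -> 'cV[R]_d),
    closed_loop_solution f g nu theta u algorithm [set` J] x thetaI ->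
    adaptation_law Gamma phi psi alpha [set` J] x
      (ff_estimate algorithm x thetaI).
Proof.
move=> u algorithm theta _ J t0 t1 _ _ _ x thetaI [x1' x2' thI'].
set thetahat := ff_estimate algorithm x thetaI in x1' x2' thI' *.
pose x' t := f (x t) + col_mx 0 (nu (x t, theta))
             + u (x t) (thetahat t) t *: g (x t).
have x1'E t : usubmx (x' t) =
    usubmx (f (x t)) + u (x t) (thetahat t) t *: usubmx (g (x t)).
  by rewrite /x' !linearD linearZ /= col_mxKu addr0.
have x2'E t : dsubmx (x' t) = dsubmx (f (x t)) + nu (x t, theta)
    + u (x t) (thetahat t) t *: dsubmx (g (x t)).
  by rewrite /x' !linearD linearZ /= col_mxKd.
have xx' : has_derivative_on [set` J] x x'.
  apply: has_derivative_on_col_mx => t Jt; first by rewrite x1'E; exact: x1'.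
  by rewrite x2'E; exact: x2'.
have psi' := has_derivative_on_trajectory psi_diff xx'.
exists (fun t => 'd psi (x t, t) (x' t, 1)); split; first exact: psi'.
have alpha' := has_derivative_on_trajectory_partials alpha_diff xx'.
have Psi' := has_derivative_on_trajectory_partials Psi_diff xx'.
have P' := has_derivative_onD (has_derivative_onZ psi' alpha')
  (has_derivative_onN Psi').
have := has_derivative_on_mulmx (A := Gamma) (has_derivative_onD P' thI').
congr has_derivative_on; apply/funext => t; congr (_ *m _).
rewrite x1'E; exact: x2_terms_cancel.
Qed.
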